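(* A function $\Psi'\in C^\infty(J_0^1)\otimes\mathbf{C}$ is $\mathrm{Diff}_+\mathbf{R}$-invariant (that is, $\Xi_\varphi\Psi'=\Psi'$ for all $\varphi\in\mathrm{Diff}_+\mathbf{R}$) if and only if $$\boldsymbol{Q}_{\mathscr{J}_\tau}\Psi'=0$$ for all $\tau\,\partial_t\in\mathrm{diff}_+\mathbf{R}$.
   Context: $J_0^1=\{(t,x,\dot x)\in\mathbf{R}\times\mathbf{R}^3\times\mathbf{R}^3\mid\dot x\ne0\}$, and $C^\infty(J_0^1)\otimes\mathbf{C}$ is the space of complex-valued smooth functions on it. $\mathrm{Diff}_+\mathbf{R}$ is the group of orientation preserving diffeomorphisms of $\mathbf{R}$, represented on $C^\infty(J_0^1)\otimes\mathbf{C}$ by $$\Xi_\varphi\Psi(t,x,\dot x)=\dot\varphi(\varphi^{-1}(t))\,\Psi\left(\varphi^{-1}(t),x,\frac{\dot x}{(\varphi^{-1})^{\cdot}(t)}\right),$$ where $(\varphi^{-1})^{\cdot}$ is the derivative of $\varphi^{-1}$. The paper takes $\mathrm{diff}_+\mathbf{R}=\{\tau(t)\partial_t\mid\tau\in C^\infty(\mathbf{R}),\ \dot\tau(t)\ne0\text{ for all }t\}$. For such $\tau$, the quantum operator of $\mathscr{J}_\tau=\tau(t)p_t-\dot\tau(t)\langle p_{\dot x},\dot x\rangle$ is $$\boldsymbol{Q}_{\mathscr{J}_\tau}=-i\hbar\,\tau\frac{\partial}{\partial t}+i\hbar\,\dot\tau\left\langle\dot x,\frac{\partial}{\partial\dot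 x}\right\rangle+i\hbar\,\dot\tau,$$ with $\hbar>0$ a constant. *)

(* Defs.v *)
From mathcomp Require Import all_boot all_order all_algebra.
From mathcomp Require Import boolp classical_sets functions reals.
From mathcomp Require Import topology normedtype derive.
From mathcomp Require Export complex.
Set Implicit Arguments.
Unset Strict Implicit.
Unset Printing Implicit Defensive.
Import Order.TTheory GRing.Theory Num.Theory.
Import numFieldNormedType.Exports.
Local Open Scope classical_set_scope.
Local Open Scope ring_scope.
Local Open Scope complex_scope.

(* [U] is meant to be open, so that derivatives at points of [U] do not depend
   on the values of [f] outside [U]. In finite dimension, [f] is C^(k+1) iff it
   is differentiable and all its directional derivatives are C^k. *)
Fixpoint Ck (R : realType) (V W : normedModType R) (k : nat) (U : set V)
    (f : V -> W) : Prop :=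
  if k is k'.+1 then
    (forall x, U x -> differentiable f x) /\ (forall v, Ck k' U ('D_v f))
  else forall x, U x -> {for x, continuous f}.

Definition smooth_on (R : realType) (V W : normedModType R) (U : set V)
    (f : V -> W) : Prop := forall k, Ck k U f.

(* Points are triples ((t, x), xdot). A function on J01 is represented by a
   total function whose values where xdot = 0 are irrelevant. *)
Definition jet (R : realType) : normedModType R :=
  (R * 'rV[R]_3 * 'rV[R]_3)%type.

Definition J01 (R : realType) : set (jet R) := [set p | p.2 != 0].

(* C^oo(U) (x) C: complex functions with smooth real and imaginary parts. *)
Definition csmooth_on (R : realType) (V : normedModType R) (U : set V)
    (f : V -> R[i]) : Prop :=
  smooth_on U (fun p => complex.Re (f p) : R) /\
  smooth_on U (fun p => complex.Im (f p) : R).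

Definition cderive (R : realType) (V : normedModType R) (f : V -> R[i])
    (v : V) (p : V) : R[i] :=
  'D_v (fun q => complex.Re (f q) : R) p +i*
  'D_v (fun q => complex.Im (f q) : R) p.

Definition dt (R : realType) (Psi : jet R -> R[i]) : jet R -> R[i] :=
  cderive Psi ((1, 0, 0) : jet R).

Definition dxdot (R : realType) (j : 'I_3) (Psi : jet R -> R[i]) :
    jet R -> R[i] :=
  cderive Psi ((0, 0, delta_mx 0 j) : jet R).

Record diffp (R : realType) := Diffp {
  diffp_fun :> R -> R;
  diffp_inv : R -> R;
  diffp_funK : cancel diffp_fun diffp_inv;
  diffp_invK : cancel diffp_inv diffp_fun;
  diffp_smooth : smooth_on setT diffp_fun;
  diffp_inv_smooth : smooth_on setT diffp_inv;
  diffp_orient : forall t, 0 < (diffp_fun^`())%classic t }.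

Definition Xi (R : realType) (phi : diffp R) (Psi : jet R -> R[i]) :
    jet R -> R[i] := fun p =>
  let: (t, x, xdot) := p in
  let phiV := diffp_inv phi in
  ((phi : R -> R)^`()%classic (phiV t))%:C *
  Psi (phiV t, x, (phiV^`()%classic t)^-1 *: xdot).

(* The vector field tau(t) d/dt is identified with its coefficient tau. *)
Definition diffp_lie (R : realType) (tau : R -> R) : Prop :=
  smooth_on setT tau /\ forall t, tau^`()%classic t != 0.

Definition QJ (R : realType) (hbar : R) (tau : R -> R) (Psi : jet R -> R[i]) :
    jet R -> R[i] := fun p =>
  let: (t, x, xdot) := p in
  let ih : R[i] := 0 +i* hbar in
  - ih * (tau t)%:C * dt Psi p
  + ih * (tau^`()%classic t)%:C *
      (\sum_(j < 3) (xdot 0 j)%:C * dxdot j Psi p)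
  + ih * (tau^`()%classic t)%:C * Psi p.

(* Main.v *)
Require Import Defs.
From mathcomp Require Import all_boot all_order all_algebra.
From mathcomp Require Import boolp classical_sets functions reals.
From mathcomp Require Import topology normedtype derive.
From mathcomp Require Import sequences exp realfun.
Import Order.TTheory GRing.Theory Num.Theory.
Import numFieldNormedType.Exports.
Local Open Scope classical_set_scope.
Local Open Scope ring_scope.
Local Open Scope complex_scope.

(** Both conditions say the same thing about [Psi]: it does not depend on [t],
    and it is positively homogeneous of degree -1 in [xdot].

    For the group, put [s = phi^-1 t]: since [(phi^-1)'(t) = 1 / phi'(s)],
    invariance under [phi] reads
    [Psi (phi s, x, xdot) = phi'(s) Psi (s, x, phi'(s) xdot)].
    Translations [s + c] make [Psi] independent of time, and the dilations
    [l s] then make it homogeneous; conversely those two properties give back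
    the identity for every [phi], the first absorbing the change of time and
    the second the positive factor [phi'(s)] ([Xi_invariantP]).

    For the algebra, the operator of [tau] is, up to the nonzero factor
    [i hbar], the combination [tau' (E + 1) - tau d/dt], where [E] is the Euler
    field [<xdot, d/dxdot>]. At a given time [t0] the admissible fields
    [tau = t - t0] and [tau = t - t0 + 1] separate the two terms, so the
    equations for all [tau] amount to [(E + 1) Psi = 0] and [d Psi / dt = 0]
    ([QJ_eq0P]).

    The two descriptions agree by integrating along curves that stay in the
    region [xdot != 0]: the time lines for [d Psi / dt = 0] ([dt_eq0P]) and the
    open rays [e^s xdot] for the Euler equation ([euler_eq0P]). Both steps are
    done for real functions and applied to the real and imaginary parts. *)

Set Implicit Arguments.
Unset Strict Implicit.
Unset Printing Implicit Defensive.

(** * Calculus on curves *)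
Section Curves.
Variable R : realType.

(** Time lines and rays are both curves [a + h u *: b], with [h] the identity
    and the exponential respectively, hence this shape. *)
Lemma is_derive_along (V : normedModType R) (f : V -> R) (h : R -> R)
    (a b : V) (s dh : R) :
  differentiable f (a + h s *: b) -> is_derive s 1 h dh ->
  is_derive s 1 (fun u => f (a + h u *: b)) (dh * 'D_b f (a + h s *: b)).
Proof.
move=> df [/derivable1_diffP ddh <-].
have dc : is_diff s (fun u => a + h u *: b) (fun u => 'd h s u *: b).
  have dZ : is_diff s (fun u => h u *: b) (fun u => 'd h s u *: b).
    by apply: DiffDef; [exact: differentiableZl | rewrite diffZl].
  have dS := is_diffD (is_diff_cst a s) dZ.
  by rewrite add0r in dS.
have dfc : differentiable (f \o (fun u => a + h u *: b)) s.
  by apply: differentiable_comp.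
apply: DeriveDef; first exact/derivable1_diffP.
rewrite deriveE // diff_comp //= !deriveE //.
by rewrite (@diff_val _ _ _ _ _ _ _ dc) linearZ.
Qed.

(** The bridge from infinitesimal to finite statements: it is used in both
    directions, along time lines and along rays. *)
Lemma is_derive_cstP (g d : R -> R) : (forall s : R, is_derive s 1 g (d s)) ->
  (forall s, d s = 0) <-> (forall s s', g s = g s').
Proof.
move=> dg; split=> [d0 s s'|gC s].
  by apply: is_derive_0_is_cst => u; rewrite -(d0 u).
have [_ <-] := dg s.
by rewrite (_ : g = cst (g 0)) ?derive_cst //; apply/funext => u; apply: gC.
Qed.

(** * Affine diffeomorphisms of the line *)
Lemma smooth_cst (V W : normedModType R) (U : set V) (c : W) :
  smooth_on U (cst c).
Proof.
move=> k; elim: k c => [|k IH] c /=.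
  by move=> x _; apply: cst_continuous.
split=> [x _ //|v].
by rewrite (_ : 'D_v _ = cst 0) //; apply/funext => x; rewrite derive_cst.
Qed.

Lemma is_derive_affine (a b s v : R) :
  is_derive s v (fun u => a * u + b) (a * v).
Proof.
have := is_deriveD (is_deriveZ a (is_derive_id s v)) (is_derive_cst b s v).
by rewrite addr0.
Qed.

Lemma derive1_affine (a b s : R) : (fun u : R => a * u + b)^`()%classic s = a.
Proof.
rewrite derive1E (@derive_val _ _ _ _ _ _ _ (is_derive_affine a b s 1)).
exact: mulr1.
Qed.

Lemma smooth_affine (a b : R) : smooth_on setT (fun s => a * s + b).
Proof.
have dif s : differentiable (fun u => a * u + b) s.
  by apply/derivable1_diffP; case: (is_derive_affine a b s 1).
case=> [|k] /=; first by move=> s _; apply: differentiable_continuous.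
split=> [s _ //|v].
have -> : 'D_v (fun s => a * s + b) = cst (a * v).
  apply/funext => s.
  exact: (@derive_val _ _ _ _ _ _ _ (is_derive_affine a b s v)).
exact: smooth_cst.
Qed.

Lemma affineK (a b : R) : 0 < a ->
  cancel (fun s => a * s + b) (fun s => a^-1 * s + - (a^-1 * b)).
Proof. by move=> a0 s; rewrite mulrDr addrK mulKf ?gt_eqF. Qed.

Lemma affineVK (a b : R) : 0 < a ->
  cancel (fun s => a^-1 * s + - (a^-1 * b)) (fun s => a * s + b).
Proof. by move=> a0 s; rewrite -mulrBr mulVKf ?gt_eqF// subrK. Qed.

Lemma affine_orient (a b : R) : 0 < a ->
  forall t, 0 < (fun s : R => a * s + b)^`()%classic t.
Proof. by move=> a0 t; rewrite derive1_affine. Qed.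

Definition affine_diffp (a b : R) (a0 : 0 < a) : diffp R :=
  Diffp (affineK b a0) (affineVK b a0) (smooth_affine a b)
    (smooth_affine a^-1 (- (a^-1 * b))) (affine_orient b a0).

(** This turns the factor acting on the velocity into the factor acting on the
    values, so that [Xi] involves the single number [phi'(s)]. *)
Lemma derive1_diffp_inv (phi : diffp R) t :
  ((diffp_inv phi)^`()%classic t)^-1 =
  (phi : R -> R)^`()%classic (diffp_inv phi t).
Proof.
have dif (f : R -> R) s : smooth_on setT f -> derivable f s 1.
  by move=> /(_ 1) /= [/(_ s I) df _]; apply/derivable1_diffP.
have := derive1_comp (dif _ t (diffp_inv_smooth phi))
                     (dif _ (diffp_inv phi t) (diffp_smooth phi)).
have -> : phi \o diffp_inv phi = id by apply/funext => s /=; rewrite diffp_invK.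
rewrite derive1_id => e; apply/esym.
apply: (mulIf (x := (diffp_inv phi)^`()%classic t)).
  by apply: contra_eqN e => /eqP->; rewrite mulr0 oner_eq0.
rewrite -e mulVf //.
by apply: contra_eqN e => /eqP->; rewrite mulr0 oner_eq0.
Qed.

End Curves.

(** * Time independence and homogeneity *)
Section Jet.
Variable R : realType.

Definition time_independent (T : Type) (F : jet R -> T) : Prop :=
  forall t t' x v, v != 0 -> F (t, x, v) = F (t', x, v).

Definition homogeneousN1 (F : jet R -> R[i]) : Prop :=
  forall l t x v, 0 < l -> v != 0 -> l%:C * F (t, x, l *: v) = F (t, x, v).

Lemma eq_complexP (z w : R[i]) :
  z = w <-> complex.Re z = complex.Re w /\ complex.Im z = complex.Im w.
Proof. by split=> [->//|]; case: z w => a b [c d] /= [-> ->]. Qed.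

Lemma time_independent_Re_Im (F : jet R -> R[i]) :
  time_independent F <-> time_independent (fun p => complex.Re (F p)) /\
                         time_independent (fun p => complex.Im (F p)).
Proof.
split=> [h|[hr hi] t t' x v v0].
  by split=> t t' x v v0; rewrite (h t t').
by apply/eq_complexP; split; [exact: hr | exact: hi].
Qed.

Lemma derive_time_independentP (f : jet R -> R) :
  (forall p, J01 p -> differentiable f p) ->
  (forall p, J01 p -> 'D_((1, 0, 0) : jet R) f p = 0) <-> time_independent f.
Proof.
move=> df.
have jetE (t : R) (x v : 'rV[R]_3) :
    (t, x, v) = ((0, x, v) : jet R) + t *: ((1, 0, 0) : jet R).
  by congr (_, _, _); rewrite /= ?scaler0 ?addr0 // add0r; apply/esym/mulr1.
have dline (x v : 'rV[R]_3) (v0 : v != 0) (t : R) :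
    is_derive t 1 (fun u => f (u, x, v))
      ('D_((1, 0, 0) : jet R) f (t, x, v)).
  rewrite (_ : (fun u => _) =
      (fun u => f (((0, x, v) : jet R) + u *: ((1, 0, 0) : jet R)))).
    rewrite jetE -[X in is_derive _ _ _ X]mul1r.
    apply: (is_derive_along (h := id)); first by rewrite -jetE; apply: df.
  by apply/funext => u; rewrite -jetE.
split=> [f0 t t' x v v0|fT [[t x] v] /= v0].
  apply: (iffLR (is_derive_cstP (dline x v v0))) => s.
  exact: f0.
by apply: (iffRL (is_derive_cstP (dline x v v0))) => s s'; apply: fT.
Qed.

(** Euler's theorem in degree -1. Dilations by [l > 0] are parametrised as
    [l = e^s]: the function [e^s * f (t, x, e^s xdot)] has derivative [e^s]
    times the left-hand side of Euler's equation at [(t, x, e^s xdot)], and its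
    parameter runs through the whole line, so that the equation holds along the
    ray exactly when that function is constant, i.e. equal to its value at
    [s = 0]. *)
Lemma euler_homogeneousP (f : jet R -> R) :
  (forall p, J01 p -> differentiable f p) ->
  (forall p, J01 p -> 'D_((0, 0, p.2) : jet R) f p + f p = 0) <->
  (forall l t x v, 0 < l -> v != 0 -> l * f (t, x, l *: v) = f (t, x, v)).
Proof.
move=> df.
have jetE (t l : R) (x v : 'rV[R]_3) :
    (t, x, l *: v) = ((t, x, 0) : jet R) + l *: ((0, 0, v) : jet R).
  by congr (_, _, _); rewrite /= ?scaler0 ?addr0 ?add0r //.
have linD (p : jet R) (l : R) (v : 'rV[R]_3) : J01 p ->
    'D_((0, 0, l *: v) : jet R) f p = l * 'D_((0, 0, v) : jet R) f p.
  move=> /df dfp; rewrite !deriveE //.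
  rewrite (_ : (0, 0, l *: v) = l *: ((0, 0, v) : jet R)) ?linearZ //.
  by congr (_, _, _); rewrite /= ?scaler0.
have J01Z (t : R) x (v : 'rV[R]_3) s : v != 0 -> @J01 R (t, x, expR s *: v).
  by move=> v0; rewrite /J01 /= scaler_eq0 negb_or v0 gt_eqF ?expR_gt0.
have dray (t : R) (x v : 'rV[R]_3) (v0 : v != 0) (s : R) :
    is_derive s 1 (fun u => expR u * f (t, x, expR u *: v))
      (expR s * ('D_((0, 0, expR s *: v) : jet R) f (t, x, expR s *: v)
                 + f (t, x, expR s *: v))).
  (* The chain rule gives the derivative along the fixed direction [v]; [linD]
     then moves the factor [e^s] inside, giving the direction of the current
     velocity [e^s v]. *)
  have dfs : is_derive s 1 (fun u => f (t, x, expR u *: v))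
      (expR s * 'D_((0, 0, v) : jet R) f (t, x, expR s *: v)).
    rewrite (_ : (fun u => _) =
      (fun u => f (((t, x, 0) : jet R) + expR u *: ((0, 0, v) : jet R)))).
      rewrite jetE.
      by apply: is_derive_along; rewrite -jetE; apply/df/J01Z.
    by apply/funext => u; rewrite -jetE.
  have := is_deriveM (is_derive_expR s) dfs.
  rewrite linD; last exact: J01Z.
  by rewrite mulrDr [f _ *: _]mulrC.
split=> [f0 l t x v l0 v0|fH [[t x] v] /= v0].
  have := iffLR (is_derive_cstP (dray t x v v0)) _ (ln l) 0.
  rewrite lnK ?posrE // expR0 mul1r scale1r; apply => s.
  by rewrite (f0 (t, x, _)) ?mulr0 //; apply: J01Z.
have := iffRL (is_derive_cstP (dray t x v v0)) _ 0.
rewrite expR0 mul1r scale1r; apply => s s'.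
by rewrite !fH ?expR_gt0.
Qed.

Lemma homogeneousN1_Re_Im (F : jet R -> R[i]) :
  homogeneousN1 F <->
  (forall l t x v, 0 < l -> v != 0 ->
     l * complex.Re (F (t, x, l *: v)) = complex.Re (F (t, x, v))) /\
  (forall l t x v, 0 < l -> v != 0 ->
     l * complex.Im (F (t, x, l *: v)) = complex.Im (F (t, x, v))).
Proof.
have ReIm (l : R) (z : R[i]) :
    l%:C * z = (l * complex.Re z) +i* (l * complex.Im z).
  by case: z => a b; rewrite /= [LHS]/GRing.mul /= !mul0r subr0 addr0.
split=> [h|[hr hi] l t x v l0 v0].
  by split=> l t x v l0 v0; rewrite -(h l t x v l0 v0) ReIm.
by rewrite ReIm hr // hi //; case: (F _).
Qed.

(** * The quantum operators and the group action *)
Lemma derive_coord (f : jet R -> R) (p : jet R) (v : 'rV[R]_3) :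
  differentiable f p ->
  'D_((0, 0, v) : jet R) f p =
  \sum_(j < 3) v 0 j * 'D_((0, 0, delta_mx 0 j) : jet R) f p.
Proof.
move=> df.
have slotD : {morph (fun w : 'rV[R]_3 => (0, 0, w) : jet R) : w w' / w + w'}.
  by move=> w w'; congr (_, _, _); rewrite /= ?addr0.
have -> : (0, 0, v) = \sum_(j < 3) v 0 j *: ((0, 0, delta_mx 0 j) : jet R).
  rewrite [in LHS](row_sum_delta v) (big_morph _ slotD (erefl _)).
  by apply: eq_bigr => j _; congr (_, _, _); rewrite /= ?scaler0.
rewrite deriveE // linear_sum; apply: eq_bigr => j _.
by rewrite linearZ deriveE.
Qed.

Lemma csmooth_differentiable (V : normedModType R) (U : set V) (F : V -> R[i]) :
  csmooth_on U F ->
  (forall p, U p -> differentiable (fun q => complex.Re (F q) : R) p) /\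
  (forall p, U p -> differentiable (fun q => complex.Im (F q) : R) p).
Proof. by move=> [/(_ 1) /= [dr _] /(_ 1) /= [di _]]. Qed.

Lemma sum_dxdotE (Psi : jet R -> R[i]) (p : jet R) :
  csmooth_on (@J01 R) Psi -> J01 p ->
  \sum_(j < 3) (p.2 0 j)%:C * dxdot j Psi p =
  cderive Psi ((0, 0, p.2) : jet R) p.
Proof.
move=> /csmooth_differentiable [dr di] p0.
rewrite /cderive !derive_coord; [|exact: di|exact: dr].
apply/eq_complexP; split; rewrite raddf_sum /=; apply: eq_bigr => j _.
  by rewrite mul0r subr0.
by rewrite mul0r addr0.
Qed.

(** The values of [tau] and [tau'] at one point can be chosen independently,
    subject to [tau' <> 0] there; affine [tau] of slope 1 suffice. *)
Lemma QJ_eq0P (hbar : R) (Psi : jet R -> R[i]) : 0 < hbar ->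
  csmooth_on (@J01 R) Psi ->
  (forall tau : R -> R, diffp_lie tau ->
     {in @J01 R, QJ hbar tau Psi =1 (fun=> 0)}) <->
  (forall p, J01 p -> dt Psi p = 0) /\
  (forall p, J01 p -> cderive Psi ((0, 0, p.2) : jet R) p + Psi p = 0).
Proof.
move=> hbar0 sPsi.
have ih0 : (0 +i* hbar : R[i]) != 0.
  by apply/eqP => /eq_complexP [_ /= h]; rewrite h ltxx in hbar0.
have QJE tau (p : jet R) : J01 p -> QJ hbar tau Psi p = (0 +i* hbar) *
    ((tau^`()%classic p.1.1)%:C * (cderive Psi ((0, 0, p.2) : jet R) p + Psi p)
     - (tau p.1.1)%:C * dt Psi p).
  move=> p0; rewrite -sum_dxdotE //; case: p p0 => [[t x] v] /= _.
  by rewrite mulrBr mulrDr mulrDr !mulrA !mulNr -addrA [LHS]addrC.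
split=> [Q0|[T0 E0] tau _ p /set_mem p0]; last first.
  by rewrite QJE // T0 // E0 // !mulr0 subrr mulr0.
(* For each point [p], with time [p.1.1], take [tau] vanishing at that time,
   which isolates the Euler term, and then [tau] equal to 1 there. *)
have lie (b : R) : diffp_lie (fun s => 1 * s + b).
  split; first exact: smooth_affine.
  by move=> t; rewrite derive1_affine oner_eq0.
have E0 p : J01 p -> cderive Psi ((0, 0, p.2) : jet R) p + Psi p = 0.
  move=> p0; have := Q0 _ (lie (- p.1.1)) p (mem_set p0).
  rewrite QJE // derive1_affine mul1r subrr !mul0r subr0 mul1r.
  by move/eqP; rewrite mulf_eq0 (negPf ih0) => /eqP.
split=> // p p0; have := Q0 _ (lie (1 - p.1.1)) p (mem_set p0).
rewrite QJE // E0 // mulr0 sub0r mul1r addrC subrK mul1r.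
by move/eqP; rewrite mulf_eq0 (negPf ih0) oppr_eq0 => /eqP.
Qed.

(** The affine group already forces time independence and homogeneity, and
    these imply invariance under all of Diff+. *)
Lemma Xi_invariantP (Psi : jet R -> R[i]) :
  (forall phi : diffp R, {in @J01 R, Xi phi Psi =1 Psi}) <->
  time_independent Psi /\ homogeneousN1 Psi.
Proof.
have XiE (phi : diffp R) s x v (a := (phi : R -> R)^`()%classic s) :
    Xi phi Psi (phi s, x, v) = a%:C * Psi (s, x, a *: v).
  by rewrite /Xi derive1_diffp_inv diffp_funK.
split=> [inv|[tPsi hPsi] phi [[t x] v] /set_mem v0].
  have affE (a b : R) (a0 : 0 < a) s x v : v != 0 ->
      a%:C * Psi (s, x, a *: v) = Psi (a * s + b, x, v).
    move=> v0.
    have <- := inv (affine_diffp b a0) (a * s + b, x, v) (mem_set v0).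
    by rewrite (XiE (affine_diffp b a0)) derive1_affine.
  have tPsi : time_independent Psi.
    move=> t t' x v v0; have := affE 1 (t - t') ltr01 t' x v v0.
    by rewrite mul1r scale1r mul1r addrC subrK.
  by split=> // l t x v l0 v0; rewrite (affE l 0) //; apply: tPsi.
(* Every point of the line is [phi s] with [s = phi^-1 t]. *)
rewrite -{1}(diffp_invK phi t) XiE hPsi //; last exact: diffp_orient.
exact: tPsi.
Qed.

Lemma dt_eq0P (Psi : jet R -> R[i]) : csmooth_on (@J01 R) Psi ->
  (forall p, J01 p -> dt Psi p = 0) <-> time_independent Psi.
Proof.
move=> /csmooth_differentiable [dr di].
rewrite time_independent_Re_Im -(derive_time_independentP dr)
  -(derive_time_independentP di).
by split=> [h|[hr hi] p p0];
  [split=> p /h /eq_complexP [] | rewrite /dt /cderive hr ?hi].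
Qed.

Lemma euler_eq0P (Psi : jet R -> R[i]) : csmooth_on (@J01 R) Psi ->
  (forall p, J01 p -> cderive Psi ((0, 0, p.2) : jet R) p + Psi p = 0) <->
  homogeneousN1 Psi.
Proof.
move=> /csmooth_differentiable [dr di].
rewrite homogeneousN1_Re_Im -(euler_homogeneousP dr) -(euler_homogeneousP di).
split=> [h|[hr hi] p p0].
  by split=> p /h /eq_complexP []; rewrite !raddfD.
by apply/eq_complexP; rewrite !raddfD /= hr ?hi.
Qed.

End Jet.

Theorem theorem5p4 (R : realType) (hbar : R) (hbar_gt0 : 0 < hbar)
    (Psi : jet R -> R[i]) (Psi_smooth : csmooth_on (@J01 R) Psi) :
  (forall phi : diffp R, {in @J01 R, Xi phi Psi =1 Psi}) <->
  (forall tau : R -> R, diffp_lie tau ->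
     {in @J01 R, QJ hbar tau Psi =1 (fun=> 0)}).
Proof.
rewrite Xi_invariantP (QJ_eq0P hbar_gt0 Psi_smooth).
by rewrite (dt_eq0P Psi_smooth) (euler_eq0P Psi_smooth).
Qed.
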